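(* For any $f_0\in R_{A_0}$ we have $$\mathrm{HF}((f_0,\mathcal{F}),(E_0,\mathbf{E});D)=0 \iff N_{f_0}\text{ has rank }\mathrm{HF}(\mathcal{F},\mathbf{E};D),$$ where $(f_0,\mathcal{F})=(f_0,f_1,\dots,f_s)$ and $(E_0,\mathbf{E})=(E_0,E_1,\dots,E_s)$. Moreover, in that case, for every solution $\zeta\in\mathbb{C}^n$ of $\mathcal{F}$ such that the vector $\zeta^D$ is non-zero, we have $f_0(\zeta)\neq0$.
   Context: Let $R=\mathbb{C}[x_1,\dots,x_n]$ and $\mathbb{N}=\{0,1,2,\dots\}$. For a finite $E\subset\mathbb{N}^n$ let $R_E=\bigoplus_{\alpha\in E}\mathbb{C}\,x^\alpha$, and for $\zeta\in\mathbb{C}^n$ let $\zeta^E=(\zeta^\alpha)_{\alpha\in E}$, a row vector (with $0^0=1$). Let $\mathcal{F}=(f_1,\dots,f_s)\in R^s$, $s\ge n$, $f_i=\sum_\alpha c_{i,\alpha}x^\alpha$, with supports $A_i=\{\alpha: c_{i,\alpha}\ne0\}$. A solution of $\mathcal{F}$ is a point $\zeta\in\mathbb{C}^n$ with $f_i(\zeta)=0$ for all $i$. Let $\mathbf{E}=(E_1,\dots,E_s)$ and $D$ be finite sets of exponents in $\mathbb{N}^n$ with $A_i+E_i\subset D$ (Minkowski sum) for $i=1,\dots,s$. The Macaulay matrix $\mathrm{M}(\mathcal{F},\mathbf{E};D)$ has rows indexed by $\alpha\in D$, columns indexed by pairs $(i,\beta)$ with $1\le i\le s$, $\beta\in E_i$,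 and entries $c_{i,\alpha-\beta}$ (zero if $\alpha-\beta\notin\mathbb{N}^n$). It represents the map $(g_1,\dots,g_s)\mapsto\sum_i g_if_i$ from $R_{E_1}\times\dots\times R_{E_s}$ to $R_D$. $\mathrm{HF}(\mathcal{F},\mathbf{E};D):=\#D-\operatorname{rank}\mathrm{M}(\mathcal{F},\mathbf{E};D)$, and the same definition is used for the tuple $(f_0,\mathcal{F})$ with exponent sets $(E_0,\mathbf{E})$. $\mathrm{Coker}(\mathcal{F},\mathbf{E};D)$ is a fixed matrix of size $\mathrm{HF}(\mathcal{F},\mathbf{E};D)\times\#D$, of rank $\mathrm{HF}(\mathcal{F},\mathbf{E};D)$, with $\mathrm{Coker}(\mathcal{F},\mathbf{E};D)\cdot\mathrm{M}(\mathcal{F},\mathbf{E};D)=0$. Let $A_0,E_0\subset\mathbb{N}^n$ be finite with $A_0+E_0\subset D$. For $f_0\in R_{A_0}$ put $N_{f_0}=\mathrm{Coker}(\mathcal{F},\mathbf{E};D)\cdot\mathrm{M}(f_0,E_0;D)$, where $\mathrm{M}(f_0,E_0;D)$ is the Macaulay matrix of the single polynomial $f_0$ with exponent set $E_0$. *)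

(* Defs.v *)
From mathcomp Require Import all_boot all_order all_algebra.
From mathcomp Require Import finmap mpoly complex reals.

Set Implicit Arguments.
Unset Strict Implicit.
Unset Printing Implicit Defensive.

Import GRing.Theory.
Local Open Scope ring_scope.

Section Macaulay.
Variables (K : fieldType) (n : nat).

Definition suppset (f : {mpoly K[n]}) : {fset 'X_{1..n}} :=
  [fset a in msupp f]%fset.

Definition minkowski (A B : {fset 'X_{1..n}}) : {fset 'X_{1..n}} :=
  [fset (a + b)%MM | a in A, b in B]%fset.

Definition monomial_vec (E : {fset 'X_{1..n}}) (z : 'I_n -> K) : 'rV[K]_#|{: E}| :=
  \row_j mmap1 z (val (enum_val j)).

Definition solution s (F : s.-tuple {mpoly K[n]}) (z : 'I_n -> K) : Prop :=
  forall i : 'I_s, (tnth F i).@[z] = 0.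

Definition colidx s (E : s.-tuple {fset 'X_{1..n}}) : finType :=
  {i : 'I_s & tnth E i}.

(* Rows and columns follow the enumerations of D and of the pairs (i, beta).
   Subtraction of multinomials is truncated, whence the divisibility test. *)
Definition macaulay s (F : s.-tuple {mpoly K[n]})
    (E : s.-tuple {fset 'X_{1..n}}) (D : {fset 'X_{1..n}}) :
    'M[K]_(#|{: D}|, #|{: colidx E}|) :=
  \matrix_(r, c)
    let a := val (enum_val r) in
    let b := val (tagged (enum_val c)) in
    if (b <= a)%MM then (tnth F (tag (enum_val c)))@_(a - b)%MM else 0.

Definition HF s (F : s.-tuple {mpoly K[n]})
    (E : s.-tuple {fset 'X_{1..n}}) (D : {fset 'X_{1..n}}) : nat :=
  (#|{: D}| - \rank (macaulay F E D))%N.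

Definition is_coker s (F : s.-tuple {mpoly K[n]})
    (E : s.-tuple {fset 'X_{1..n}}) (D : {fset 'X_{1..n}})
    (C : 'M[K]_(HF F E D, #|{: D}|)) : Prop :=
  \rank C = HF F E D /\ C *m macaulay F E D = 0.

End Macaulay.

(* Main.v *)
(* A row vector v indexed by D is a linear functional on R_D, and v kills the
   Macaulay matrix of F iff this functional vanishes on every x^beta f_i with
   beta in E_i. Hence the left kernel for (f0, F) is the intersection of those
   for f0 and for F, the latter being the row space of Coker. So a vector in the
   left kernel for (f0, F) is u *m Coker with u in the left kernel of N_f0, and
   HF = 0 means that there is no nonzero such vector. At a solution zeta of F
   with f0(zeta) = 0, the functional zeta^D is evaluation at zeta, which vanishes
   on all x^beta f_i, so that zeta^D must be 0. *)
Require Import Defs.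
From mathcomp Require Import all_boot all_order all_algebra.
From mathcomp Require Import finmap mpoly complex reals.

Set Implicit Arguments.
Unset Strict Implicit.
Unset Printing Implicit Defensive.

Import GRing.Theory.
Local Open Scope ring_scope.

Lemma row_freeP (K : fieldType) (m p : nat) (A : 'M[K]_(m, p)) :
  reflect (forall v : 'rV_m, v *m A = 0 -> v = 0) (row_free A).
Proof.
apply: (iffP idP) => [Afree v vA0 | inj0].
  by apply: (row_free_inj Afree); rewrite /= vA0 mul0mx.
rewrite -kermx_eq0; apply/eqP/row_matrixP => i; rewrite row0.
by apply: inj0; rewrite -row_mul mulmx_ker row0.
Qed.

Section MacaulayKernel.
Variables (K : fieldType) (n : nat).
Implicit Types (p : {mpoly K[n]}) (A E D : {fset 'X_{1..n}}) (z : 'I_n -> K).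

(** The right-hand side is the shape of a Macaulay entry, so column [(i, b)] lists the coefficients
    of [x^b f_i] on [D]. *)
Lemma mcoeffMXE p (b a : 'X_{1..n}) :
  (p * 'X_[b])@_a = if (b <= a)%MM then p@_(a - b)%MM else 0.
Proof.
case: ifPn => [le_ba | nle_ba].
  by rewrite -{1}(submK le_ba) addmC mcoeffMX.
apply: memN_msupp_eq0; rewrite (perm_mem (msuppMX _ _)).
by apply: contraNN nle_ba => /mapP[c _ ->]; rewrite lem_addr.
Qed.

Lemma suppset_minkowskiE p A E D b :
    (suppset p `<=` A)%fset -> (minkowski A E `<=` D)%fset -> b \in E ->
  {subset msupp (p * 'X_[b]) <= D}.
Proof.
move=> /fsubsetP sA /fsubsetP sD bE a; rewrite (perm_mem (msuppMX _ _)).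
case/mapP=> c cp ->; apply: sD; rewrite addmC.
by apply: in_imfset2 => //=; apply: sA; rewrite inE.
Qed.

(** Coefficients of [p] outside [D] are ignored, so this is the functional of [v] on [R_D] composed
    with truncation to [D]. *)
Definition row_form D (v : 'rV[K]_#|{: D}|) p : K :=
  \sum_r v 0 r * p@_(val (enum_val r)).

Lemma row_form_monomial_vec D z p :
  {subset msupp p <= D} -> row_form (monomial_vec D z) p = p.@[z].
Proof.
move=> sD.
pose G (a : 'X_{1..n}) := p@_a * mmap1 z a.
have -> : row_form (monomial_vec D z) p = \sum_(a <- D) G a.
  rewrite big_seq_fsetE /= big_enum_val; apply: eq_bigr => r _.
  by rewrite mxE mulrC.
(* The exponents of [D] outside the support contribute zero, so the sum shrinks to the one defining
   evaluation. *)
rewrite mevalE -(big_fset_incl _ (A := suppset p)) /=.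
- rewrite [LHS](perm_big (msupp p)) //.
  apply: uniq_perm; rewrite ?fset_uniq ?msupp_uniq // => a.
  by rewrite inE.
- by apply/fsubsetP => a; rewrite inE; apply: sD.
- by move=> a _; rewrite inE => /memN_msupp_eq0 pa0; rewrite /G pa0 mul0r.
Qed.

Lemma mulmx_macaulay_eq0 s (F : s.-tuple {mpoly K[n]})
    (E : s.-tuple {fset 'X_{1..n}}) D (v : 'rV[K]_#|{: D}|) :
  v *m macaulay F E D = 0 <->
  forall (i : 'I_s) b, b \in tnth E i -> row_form v (tnth F i * 'X_[b]) = 0.
Proof.
have entryE c : (v *m macaulay F E D) 0 c =
    row_form v (tnth F (tag (enum_val c)) * 'X_[val (tagged (enum_val c))]).
  by rewrite mxE; apply: eq_bigr => r _; rewrite mxE mcoeffMXE.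
split=> [vM0 i b bE | vF0].
  pose x : colidx E := Tagged (fun i => tnth E i : Type) [` bE]%fset.
  by have := entryE (enum_rank x); rewrite vM0 mxE enum_rankK.
by apply/rowP => c; rewrite entryE mxE; apply: vF0; apply: valP.
Qed.

Lemma mulmx_macaulay1_eq0 p E D (v : 'rV[K]_#|{: D}|) :
  v *m macaulay [tuple p] [tuple E] D = 0 <->
  forall b, b \in E -> row_form v (p * 'X_[b]) = 0.
Proof.
rewrite mulmx_macaulay_eq0; split=> [vp0 b bE | vp0 i b].
  exact: (vp0 ord0).
by rewrite ord1; apply: vp0.
Qed.

Lemma mulmx_macaulay_cons_eq0 s p (F : s.-tuple {mpoly K[n]}) E0
    (E : s.-tuple {fset 'X_{1..n}}) D (v : 'rV[K]_#|{: D}|) :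
  v *m macaulay [tuple of p :: F] [tuple of E0 :: E] D = 0 <->
  v *m macaulay [tuple p] [tuple E0] D = 0 /\ v *m macaulay F E D = 0.
Proof.
rewrite mulmx_macaulay1_eq0 !mulmx_macaulay_eq0; split=> [vpF0 | [vp0 vF0] i b].
  split=> [b bE | i b bE]; first exact: (vpF0 ord0).
  by have := vpF0 (lift ord0 i) b; rewrite !tnthS; apply.
case: (unliftP ord0 i) => [j | ] ->; last exact: vp0.
by rewrite !tnthS; apply: vF0.
Qed.

(** The rank never exceeds the number of rows, so a zero truncated difference forces equality. *)
Lemma HF_eq0 s (F : s.-tuple {mpoly K[n]}) (E : s.-tuple {fset 'X_{1..n}}) D :
  HF F E D = 0%N <-> row_free (macaulay F E D).
Proof.
rewrite /HF /row_free eqn_leq rank_leq_row /=.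
by split=> [/eqP | ?]; [|apply/eqP]; rewrite subn_eq0.
Qed.

(** The rows of [C] lie in the left kernel, whose dimension [#D - rank] is exactly the rank of
    [C]. *)
Lemma is_coker_kermx s (F : s.-tuple {mpoly K[n]})
    (E : s.-tuple {fset 'X_{1..n}}) D (C : 'M[K]_(HF F E D, #|{: D}|)) :
  is_coker C -> (C :=: kermx (macaulay F E D))%MS.
Proof.
case=> rC CM0; apply/eqmxP; rewrite -mxrank_leqif_eq; last exact/sub_kermxP.
by rewrite rC mxrank_ker.
Qed.

Lemma HF_cons_eq0 s p (F : s.-tuple {mpoly K[n]}) E0
    (E : s.-tuple {fset 'X_{1..n}}) D (C : 'M[K]_(HF F E D, #|{: D}|)) :
  is_coker C ->
  HF [tuple of p :: F] [tuple of E0 :: E] D = 0%N <->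
  \rank (C *m macaulay [tuple p] [tuple E0] D) = HF F E D.
Proof.
move=> hC; have kerC := is_coker_kermx hC; have [rC CM0] := hC.
have Cfree : row_free C by rewrite /row_free rC.
rewrite HF_eq0; split=> [/row_freeP pFfree | /eqP/row_freeP Nfree].
  apply/eqP/row_freeP => u; rewrite mulmxA => uCM0.
  (* Since [C] has full row rank, [u = 0] reduces to [u *m C = 0], and [u *m C] kills both
     blocks. *)
  apply: (row_free_inj Cfree); rewrite /= mul0mx; apply: pFfree.
  by apply/mulmx_macaulay_cons_eq0; split=> //; rewrite -mulmxA CM0 mulmx0.
apply/row_freeP => v /mulmx_macaulay_cons_eq0[vp0 /sub_kermxP].
rewrite -kerC => /submxP[u def_v]; move: vp0.
by rewrite def_v -mulmxA => /Nfree ->; rewrite mul0mx.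
Qed.

Lemma mulmx_monomial_vec_macaulay_eq0 s (F : s.-tuple {mpoly K[n]})
    (E : s.-tuple {fset 'X_{1..n}}) D z :
    (forall i, minkowski (suppset (tnth F i)) (tnth E i) `<=` D)%fset ->
  solution F z -> monomial_vec D z *m macaulay F E D = 0.
Proof.
move=> sD Fz0; apply/mulmx_macaulay_eq0 => i b bE.
(* What remains is that [x^b f_i] has its support in [D], so that the functional is evaluation at
   [z]. *)
rewrite row_form_monomial_vec ?mevalM ?Fz0 ?mul0r //.
exact: suppset_minkowskiE (fsubset_refl _) (sD i) bE.
Qed.

End MacaulayKernel.

Theorem lemma2p1 (R : realType) (n s : nat) (hs : (n <= s)%N)
    (F : s.-tuple {mpoly R[i][n]})
    (E : s.-tuple {fset 'X_{1..n}}) (D : {fset 'X_{1..n}})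
    (hAE : forall i : 'I_s,
        (minkowski (suppset (tnth F i)) (tnth E i) `<=` D)%fset)
    (Coker : 'M[R[i]]_(HF F E D, #|{: D}|)) (hC : is_coker Coker)
    (A0 E0 : {fset 'X_{1..n}}) (hAE0 : (minkowski A0 E0 `<=` D)%fset)
    (f0 : {mpoly R[i][n]}) (hf0 : (suppset f0 `<=` A0)%fset) :
  (HF [tuple of f0 :: F] [tuple of E0 :: E] D = 0%N <->
   \rank (Coker *m macaulay [tuple f0] [tuple E0] D) = HF F E D) /\
  (HF [tuple of f0 :: F] [tuple of E0 :: E] D = 0%N ->
   forall z : 'I_n -> R[i],
     solution F z -> monomial_vec D z <> 0 -> f0.@[z] <> 0).
Proof.
split=> [|/HF_eq0/row_freeP pFfree z Fz0 zD f0z]; first exact: HF_cons_eq0.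
(* Full row rank of the extended matrix would make the row [zeta^D] zero once it kills both
   blocks. *)
apply/zD/pFfree/mulmx_macaulay_cons_eq0.
split; last exact: mulmx_monomial_vec_macaulay_eq0.
apply/mulmx_macaulay1_eq0 => b bE0.
rewrite row_form_monomial_vec ?mevalM ?f0z ?mul0r //.
exact: suppset_minkowskiE hf0 hAE0 bE0.
Qed.
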